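(* Let $d$ be a fixed positive integer, let $\varepsilon>0$ be fixed, let $np=(1+\varepsilon)d\log n$, and let $Y=Y(n,p;d)$. There exists $\delta>0$ such that with high probability the following holds: for every tightly connected set $S\subset Y^{(d-1)}$ with $|S|\le\frac12\binom{n}{d}$, setting $$B_S=\{\rho\in\partial^+S:\partial\rho\subset S\},$$ we have $$|(\partial^+S\setminus B_S)\cap Y^{(d)}|\ge\delta\,|\partial^+S\cap Y^{(d)}|.$$
   Context: $\log$ is the natural logarithm. $Y(n,p;d)$ is the random $d$-dimensional simplicial complex on $[n]$ containing all subsets of size at most $d$ as faces ($Y^{(d-1)}$ is the set of all $d$-subsets of $[n]$), in which each $(d+1)$-subset of $[n]$ is a $d$-face independently with probability $p$; $Y^{(d)}$ is the set of $d$-faces. With high probability means with probability tending to $1$ as $n\to\infty$. For $S\subseteq Y^{(d-1)}$, $\partial^+S$ is the set of $(d+1)$-element subsets $\rho\subseteq[n]$ containing some $\sigma\in S$, and for such $\rho$, $\partial\rho$ is the set of its $d$-element subsets. For distinct $\sigma,\sigma'\in Y^{(d-1)}$ write $\sigma\sim\sigma'$ if some $\rho\in Y^{(d)}$ contains both. A set $X\subseteq Y^{(d-1)}$ is tightly connected if for all distinct $\sigma,\sigma'\in X$ there are $m\ge1$ and $\sigma=\delta_0,\dots,\delta_m=\sigma'$ in $X$ with $\delta_i\sim\delta_{i+1}$ for all $0\le i\le m-1$. *)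

(* Defs.v *)
From mathcomp Require Import all_boot all_order all_algebra.
From mathcomp Require Import all_classical all_reals all_analysis.

Set Implicit Arguments.
Unset Strict Implicit.
Unset Printing Implicit Defensive.

Import Order.TTheory GRing.Theory Num.Theory.
Import numFieldNormedType.Exports.

Local Open Scope set_scope.
Local Open Scope ring_scope.

(* The vertex set [n] is 'I_n, and a simplicial complex on [n] is the finite  *)
(* set of its faces, the empty face included.                                 *)

Definition ksubsets (n k : nat) : {set {set 'I_n}} :=
  [set s : {set 'I_n} | #|s| == k].

(* Y^(k): a face of dimension k has k + 1 vertices. *)
Definition faces (n : nat) (Y : {set {set 'I_n}}) (k : nat) :
  {set {set 'I_n}} := Y :&: ksubsets n k.+1.

(* An outcome of Y(n, p; d) is determined by its set F of d-faces. *)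
Definition LM_complex (n d : nat) (F : {set {set 'I_n}}) : {set {set 'I_n}} :=
  [set s : {set 'I_n} | (#|s| <= d)%N] :|: F.

(* The probability that Y(n, p; d) satisfies E: F ranges over the sets of     *)
(* (d+1)-subsets of [n], and its weight is the product of independent         *)
(* Bernoulli(p) weights. It is a probability for 0 <= p <= 1.                 *)
Definition LM_prob (R : realType) (n : nat) (p : R) (d : nat)
    (E : {set {set 'I_n}} -> Prop) : R :=
  \sum_(F in powerset (ksubsets n d.+1) | `[< E (LM_complex d F) >])
    \prod_(rho in ksubsets n d.+1) (if rho \in F then p else 1 - p).

Definition upper_boundary (n d : nat) (S : {set {set 'I_n}}) :
    {set {set 'I_n}} :=
  [set rho in ksubsets n d.+1 | [exists sigma in S, sigma \subset rho]].

Definition boundary (n d : nat) (rho : {set 'I_n}) : {set {set 'I_n}} :=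
  [set sigma in ksubsets n d | sigma \subset rho].

Definition inner_cofaces (n d : nat) (S : {set {set 'I_n}}) :
    {set {set 'I_n}} :=
  [set rho in upper_boundary d S | boundary d rho \subset S].

Definition adjacent (n d : nat) (Y : {set {set 'I_n}})
    (sigma sigma' : {set 'I_n}) : Prop :=
  [/\ sigma \in faces Y d.-1, sigma' \in faces Y d.-1, sigma <> sigma' &
      exists2 rho, rho \in faces Y d & sigma \subset rho /\ sigma' \subset rho].

Definition tightly_connected (n d : nat) (Y X : {set {set 'I_n}}) : Prop :=
  X \subset faces Y d.-1 /\
  forall sigma sigma' : {set 'I_n}, sigma \in X -> sigma' \in X ->
    sigma <> sigma' ->
    exists (m : nat) (delta : nat -> {set 'I_n}),
      [/\ (1 <= m)%N, delta 0%N = sigma, delta m = sigma',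
          forall i, (i <= m)%N -> delta i \in X &
          forall i, (i < m)%N -> adjacent d Y (delta i) (delta i.+1)].

Definition edge_expanding (R : realType) (n d : nat) (delta : R)
    (Y : {set {set 'I_n}}) : Prop :=
  forall S : {set {set 'I_n}}, tightly_connected d Y S ->
    #|S|%:R <= 2^-1 * 'C(n, d)%:R :> R ->
    delta * #|upper_boundary d S :&: faces Y d|%:R <=
    #|(upper_boundary d S :\: inner_cofaces d S) :&: faces Y d|%:R.

(* Main.v *)
Require Import Defs.
From mathcomp Require Import all_boot all_order all_algebra.
From mathcomp Require Import all_classical all_reals all_analysis.
From mathcomp Require Import fintype finset ring lra zify.

(* Fix [S] with [s] elements, put [L = ln n], and let [a] and [b] count the   *)
(* mixed and the inner cofaces of [S]. With high probability all degrees are  *)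
(* O(L), so at most O(s L) cofaces of [S] are present, and it is enough to    *)
(* find a constant times [s L] present mixed cofaces for every connected [S]. *)
(* By Chernoff, a given [S] fails with probability about [exp (- p a)], and   *)
(* counting incidences gives [s (n - d) <= d a + (d + 1) b]. The              *)
(* Kruskal-Katona type bound [(d + 1) b <= t s] for [s d! <= t ^ d] then      *)
(* yields three regimes for the union bound over [S].                         *)
(* - [s = O(1)]: [a] is about [s n], so the failure probability is at most    *)
(*   [n ^ (- (1 + c) d s)], which beats the [n ^ (d s)] sets of size [s].     *)
(* - [s = o(n ^ d)]: [a] is at least about [s n / d], and the probability     *)
(*   [n ^ (- (1 + c) s)] beats the number of connected sets, which is         *)
(*   [n ^ d (C n) ^ s] by a percolation argument; this needs [s] to exceed a  *)
(*   constant.                                                                *)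
(* - [s] of order [n ^ d], at most half of all [d]-sets: [a] is at least a    *)
(*   constant times [s n], and [n ^ (- c s)] beats the number of all sets.    *)

(** How the outline maps to the lemmas: [edge_expanding_degree] is the deterministic reduction to a
    degree bound and a lower bound on present mixed cofaces. The isoperimetry is in
    [mixed_cofaces_ge_small], which keeps the full factor [n] per element of a bounded set, and in
    [mixed_cofaces_ge], which rests on [inner_cofaces_le] and loses a factor [d]. Because of that
    loss, counting all sets of size [s] is too expensive in the middle regime; there connectedness
    pays, through [sum_connected_expr]. [candidate_failure] bounds one set by regime and
    [sum_candidate_failure] adds up the regimes; every contribution is [O(n ^ (- kappa))]. *)

Set Implicit Arguments.
Unset Strict Implicit.
Unset Printing Implicit Defensive.

Import Order.TTheory GRing.Theory Num.Theory.
Import numFieldNormedType.Exports.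

Local Open Scope ring_scope.

(** * Random subsets with independent elements: generating function and Chernoff bound *)

Section RandomSubset.
Variables (R : realType) (T : finType).
Implicit Types (U A F S W : {set T}) (p x : R).

Definition bernoulli_weight p U F : R :=
  \prod_(i in U) (if i \in F then p else 1 - p).

Lemma sum_powerset_prod U (f g : T -> R) :
  \sum_(F in powerset U) \prod_(i in U) (if i \in F then f i else g i) =
  \prod_(i in U) (f i + g i).
Proof.
rewrite [RHS]big_mkcond /=.
(* Off [U] the pair of factors is (0, 1), so the expansion over all subsets of [T] keeps only those
   inside [U]. *)
rewrite (eq_bigr (fun i => (if i \in U then f i else 0) +
                           (if i \in U then g i else 1))); last first.
  by move=> i _; case: ifP => //; rewrite add0r.
rewrite bigA_distr big_mkcond /=; apply: eq_bigr => F _.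
rewrite powersetE; case: ifPn => [sFU|/subsetPn[i iF iU]].
  rewrite big_mkcond /=; apply: eq_bigr => i _.
  case: (boolP (i \in U)) => // iU; case: ifP => // iF.
  by rewrite (subsetP sFU _ iF) in iU.
by rewrite (bigD1 i) //= iF (negbTE iU) mul0r.
Qed.

Lemma bernoulli_weight_ge0 p U F : 0 <= p <= 1 -> 0 <= bernoulli_weight p U F.
Proof.
case/andP=> p0 p1; apply: prodr_ge0 => i _.
by case: ifP => // _; rewrite subr_ge0.
Qed.

Lemma sum_bernoulli_weight p U :
  \sum_(F in powerset U) bernoulli_weight p U F = 1.
Proof.
by rewrite sum_powerset_prod big1 // => i _; rewrite addrC subrK.
Qed.

(** The power of [z] splits over the elements of [A], so the sum is again a product, with factor
    [p z + 1 - p] on [A] and 1 elsewhere. *)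
Lemma bernoulli_weight_pgf p z U A : A \subset U ->
  \sum_(F in powerset U) bernoulli_weight p U F * z ^+ #|A :&: F| =
  (1 + p * (z - 1)) ^+ #|A|.
Proof.
move=> sAU.
pose f i := p * (if i \in A then z else 1).
transitivity (\prod_(i in U) (f i + (1 - p))).
  rewrite -sum_powerset_prod; apply: eq_bigr => F _.
  rewrite -prodr_const big_mkcond /= /bernoulli_weight.
  have -> : \prod_i (if i \in A :&: F then z else 1) =
            \prod_(i in U) (if i \in A :&: F then z else 1).
    rewrite [RHS]big_mkcond; apply: eq_bigr => i _.
    rewrite in_setI; case: ifP => [/andP[iA _]|_]; last by case: ifP.
    by rewrite (subsetP sAU).
  rewrite -big_split; apply: eq_bigr => i _ /=.
  by rewrite inE /f; case: (i \in A) => /=; case: (i \in F); rewrite ?mulr1.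
rewrite -prodr_const (big_setID A) /= (setIidPr sAU) [X in _ * X]big1 ?mulr1.
  by apply: eq_bigr => i iA; rewrite /f iA; ring.
by move=> i; rewrite inE => /andP[/negbTE iA _]; rewrite /f iA; ring.
Qed.

(* Taking [theta] positive or negative gives the upper or the lower tail. *)
Lemma bernoulli_weight_chernoff p (theta m : R) U A : 0 <= p <= 1 -> A \subset U ->
  \sum_(F in powerset U | theta * m <= theta * #|A :&: F|%:R)
     bernoulli_weight p U F <=
  expR (p * #|A|%:R * (expR theta - 1) - theta * m).
Proof.
move=> p01 sAU.
apply: (@le_trans _ _ (expR (- (theta * m)) *
   \sum_(F in powerset U) bernoulli_weight p U F * expR theta ^+ #|A :&: F|)).
  rewrite mulr_sumr big_mkcondr /=; apply: ler_sum => F _.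
  have w0 := bernoulli_weight_ge0 U F p01.
  case: ifP => h; last by rewrite !mulr_ge0 ?exprn_ge0 ?expR_ge0.
  rewrite mulrCA -expRM_natr -expRD -[leLHS]mulr1 ler_wpM2l //.
  by rewrite leNgt expR_lt1 -leNgt addrC subr_ge0.
rewrite bernoulli_weight_pgf // (addrC _ (- (theta * m))) expRD ler_wpM2l ?expR_ge0 //.
rewrite (mulrC p #|A|%:R) -mulrA expRM_natl lerXn2r ?nnegrE ?expR_ge0 ?expR_ge1Dx //.
have [p0 p1] := andP p01; have := expR_ge0 theta; nra.
Qed.

End RandomSubset.

(** * Counting connected sets in a graph of bounded degree by percolation *)

Section ConnectedSets.
Variables (R : realType) (T : finType) (e : rel T).
Implicit Types (S W : {set T}).

(** Connectedness of the induced graph by closed sets instead of paths; uniqueness of components is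
    then immediate. *)
Definition cut_connected S : Prop :=
  forall A : {set T}, (exists2 x, x \in A & x \in S) ->
    (forall x y, x \in A -> x \in S -> y \in S -> e x y -> y \in A) ->
    S \subset A.

Definition outer_nbhs S := [set y | (y \notin S) && [exists x in S, e x y]].

Lemma card_outer_nbhs (D : nat) S :
  (forall x, (#|[set y | e x y]| <= D)%N) -> (#|outer_nbhs S| <= D * #|S|)%N.
Proof.
move=> hD; apply: (@leq_trans #|\bigcup_(x in S) [set y | e x y]|).
  apply/subset_leq_card/subsetP => y; rewrite inE => /andP[_ /existsP[x /andP[xS xy]]].
  by apply/bigcupP; exists x; rewrite ?inE.
rewrite mulnC -sum_nat_const; elim/big_rec2: _ => [|x m A _ leA].
  by rewrite cards0.
by apply: leq_trans (leq_card_setU _ _) _; apply: leq_add.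
Qed.

(* In a random set [W] of density [x], [S] is the component of [v] when [W]   *)
(* contains [S] and misses its neighbours; these events are disjoint.         *)
Lemma sum_cut_connected (x : R) (D : nat) (v : T) :
  0 <= x <= 1 -> (forall y, (#|[set z | e y z]| <= D)%N) ->
  \sum_(S : {set T} | (v \in S) && `[< cut_connected S >])
     (x * (1 - x) ^+ D) ^+ #|S| <= 1.
Proof.
move=> x01 hD; have [x0 x1] := andP x01.
(* The zeros encode the event: no element of [outer_nbhs S] may be in [W], and no element of [S] may
   be missing. *)
pose f S i := if i \in outer_nbhs S then 0 else x.
pose g S i := if i \in S then 0 else 1 - x.
pose term S W := \prod_(i in [set: T]) (if i \in W then f S i else g S i).
have termE S W : term S W =
    if (S \subset W) && [disjoint outer_nbhs S & W] then
      bernoulli_weight x [set: T] W else 0.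
  case: ifPn => [/andP[SW dW]|].
    apply: eq_bigr => i _; case: ifPn => iW; rewrite /f /g.
      by rewrite (disjointFl dW iW).
    by case: ifP => // iS; rewrite (subsetP SW _ iS) in iW.
  rewrite negb_and => /orP[/subsetPn[i iS iW]|].
    by rewrite /term (bigD1 i) //= (negbTE iW) /g iS mul0r.
  rewrite -setI_eq0 => /set0Pn[i]; rewrite inE => /andP[iN iW].
  by rewrite /term (bigD1 i) //= iW /f iN mul0r.
rewrite -[leRHS](sum_bernoulli_weight x [set: T]).
apply: (@le_trans _ _ (\sum_(S : {set T} | (v \in S) && `[< cut_connected S >])
    \sum_(W in powerset [set: T]) term S W)).
  apply: ler_sum => S _; rewrite sum_powerset_prod.
  have disjN i : i \in S -> i \notin outer_nbhs S by rewrite !inE => ->.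
  have -> : \prod_(i in [set: T]) (f S i + g S i) =
            x ^+ #|S| * (1 - x) ^+ #|outer_nbhs S|.
    rewrite -!prodr_const (big_setID S) /= setTI; congr (_ * _).
      by apply: eq_bigr => i iS; rewrite /f /g iS (negbTE (disjN _ iS)) addr0.
    rewrite (big_setID (outer_nbhs S)) /= [X in _ * X]big1 ?mulr1.
      apply: eq_big => i; first by rewrite !inE; case: (i \in S).
      by rewrite in_setI in_setD /f /g => /andP[/andP[/negbTE-> _] ->]; rewrite add0r.
    move=> i; rewrite /f /g !in_setD => /andP[/negbTE-> /andP[/negbTE-> _]].
    by rewrite addrC subrK.
  rewrite exprMn -exprM ler_wpM2l ?exprn_ge0 //.
  apply: ler_wiXn2l; [by rewrite subr_ge0|by lra|exact: card_outer_nbhs].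
rewrite exchange_big /=; apply: ler_sum => W _.
under eq_bigr do rewrite termE.
rewrite -big_mkcondr /=.
pose P (S : {set T}) := [&& (v \in S) && `[< cut_connected S >], S \subset W
                         & [disjoint outer_nbhs S & W]].
rewrite (eq_bigl P) //.
have w0 := bernoulli_weight_ge0 [set: T] W x01.
case: (pickP P) => [S0 P0|nP]; last by rewrite big_pred0.
rewrite (bigD1 S0) //= big1 ?addr0 // => S /andP[PS nS].
(* [S2] is closed inside [S1]: a neighbour of [S2] in [S1] lies in [W], hence not in
   [outer_nbhs S2]. *)
have incl S1 S2 : P S1 -> P S2 -> S1 \subset S2.
  move=> /andP[/andP[v1 /asboolP c1] /andP[sW1 _]] /andP[/andP[v2 _] /andP[_ d2]].
  apply: c1 => [|a b a2 a1 b1 ab]; first by exists v.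
  case: (boolP (b \in S2)) => // b2.
  have := disjointFl d2 (subsetP sW1 _ b1).
  by rewrite inE b2 /= => /existsP[]; exists a; rewrite a2.
by case/eqP: nS; apply/eqP; rewrite eqEsubset !incl.
Qed.

End ConnectedSets.

(** * Inner and mixed cofaces of a family of [d]-sets *)

Section Isoperimetry.
Variable n : nat.
Implicit Types (S A F : {set {set 'I_n}}) (sigma rho tau : {set 'I_n}) (d : nat).

Definition star tau A := [set x in A | tau \subset x].

(** Double counting of the pairs of [x] in [star tau A] and [v] in [x :\: tau]. *)
Lemma sum_card_star i tau A :
  (forall x, x \in A -> #|x| = (#|tau| + i)%N) ->
  (\sum_(v | v \notin tau) #|star (v |: tau) A| = i * #|star tau A|)%N.
Proof.
move=> hA; under eq_bigr do rewrite -sum1_card big_mkcond /=.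
rewrite exchange_big /= mulnC -sum_nat_const [RHS]big_mkcond /=.
apply: eq_bigr => x _; rewrite -big_mkcondr /= sum1_card.
case: (boolP (x \in star tau A)) => [|xN].
  rewrite inE => /andP[xA tx].
  rewrite (_ : #|_| = #|x :\: tau|).
    by rewrite cardsD (setIidPr tx) hA // addKn.
  by apply: eq_card => v; rewrite unfold_in /= !inE xA subUset sub1set tx andbT.
apply: eq_card0 => v; rewrite unfold_in /= !inE subUset.
by apply: contraNF xN; rewrite inE => /and4P[_ -> _ ->].
Qed.

Lemma card_facets d rho : #|rho| = d.+1 -> #|boundary d rho| = d.+1.
Proof.
move=> hr; rewrite -[RHS]binSn -hr -cards_draws; apply: eq_card => s.
by rewrite !inE andbC.
Qed.

Lemma inner_cofacesP d S rho : reflect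
  [/\ #|rho| = d.+1, rho \in upper_boundary d S &
      forall s : {set 'I_n}, #|s| = d -> s \subset rho -> s \in S]
  (rho \in inner_cofaces d S).
Proof.
rewrite [X in reflect _ X]inE; apply: (iffP andP) => [[rU /subsetP bS]|[hr rU bS]].
  split=> //; first by move: rU; rewrite !inE => /andP[/eqP].
  by move=> s hs sr; apply: bS; rewrite !inE hs eqxx.
split=> //; apply/subsetP => s; rewrite !inE => /andP[/eqP].
exact: bS.
Qed.

(** Deleting [v] is injective on sets containing [v], and turns an inner coface into a facet, which
    is in [S]. *)
Lemma card_star_inner_cofaces d S tau v : v \notin tau ->
  (#|star (v |: tau) (inner_cofaces d S)| <= #|star tau S|)%N.
Proof.
move=> vt; rewrite -(@card_in_imset _ _ (fun rho : {set 'I_n} => rho :\ v)).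
  apply/subset_leq_card/subsetP => _ /imsetP[rho + ->].
  rewrite inE subUset sub1set => /andP[/inner_cofacesP[hr _ bS] /andP[vr tr]].
  rewrite inE subsetD1 tr vt !andbT; apply: bS; last exact: subD1set.
  by have := cardsD1 v rho; rewrite vr hr => -[].
move=> r1 r2; rewrite !inE !subUset !sub1set.
by move=> /andP[_ /andP[v1 _]] /andP[_ /andP[v2 _]] e; rewrite -(setD1K v1) e setD1K.
Qed.

(* Local form of the Kruskal-Katona bound, by downward induction on the face  *)
(* [tau]: if the link of [v |: tau] is too large for the induction            *)
(* hypothesis, deleting [v] already gives the bound.                          *)
Lemma star_inner_cofaces_le (R : realType) (t : R) d S j tau : 0 <= t ->
  S \subset ksubsets n d ->
  (#|tau| + j.+1)%N = d ->
  #|star tau S|%:R * (j.+1)`!%:R <= t ^+ j.+1 ->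
  (j.+2)%:R * #|star tau (inner_cofaces d S)|%:R <= t * #|star tau S|%:R.
Proof.
move=> t0 /subsetP Sd; elim: j tau => [|j IH] tau htau hS.
all: have cS x : x \in S -> #|x| = d by move=> /Sd; rewrite inE => /eqP.
all: have cB x : x \in inner_cofaces d S -> #|x| = d.+1
  by move=> /inner_cofacesP[].
(* Base case, [tau] of size [d - 1]: if some inner coface contains [v |: tau], then [v |: tau] is
   itself in [S], and at most [t] inner cofaces contain it. *)
- rewrite -natrM -(@sum_card_star 2 tau); last by move=> x /cB ->; lia.
  rewrite -[#|star tau S|]mul1n -(@sum_card_star 1 tau); last by move=> x /cS ->; lia.
  rewrite !natr_sum mulr_sumr; apply: ler_sum => v vt.
  have le1 := card_star_inner_cofaces d S vt.
  case: (posnP #|star (v |: tau) (inner_cofaces d S)|) => [->|].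
    by rewrite mulr_ge0.
  case/card_gt0P => rho; rewrite inE => /andP[/inner_cofacesP[hr _ bS] sr].
  have : v |: tau \in star (v |: tau) S.
    by rewrite inE subxx andbT bS // cardsU1 vt; lia.
  move=> h; have {h} : (0 < #|star (v |: tau) S|)%N by apply/card_gt0P; exists (v |: tau).
  rewrite -(ler_nat R) in le1; rewrite -(ler_nat R) => s1.
  rewrite expr1 mulr1 in hS; nra.
- rewrite -natrM -(@sum_card_star j.+3 tau); last by move=> x /cB ->; lia.
  rewrite -(ler_pM2l (_ : 0 < j.+2%:R :> R)) ?ltr0n //.
  rewrite mulrCA -[X in _ <= t * X]natrM -(@sum_card_star j.+2 tau); last first.
    by move=> x /cS ->; lia.
  rewrite !natr_sum !mulr_sumr; apply: ler_sum => v vt.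
  have htv : (#|v |: tau| + j.+1)%N = d by rewrite cardsU1 vt; lia.
  have le1 := card_star_inner_cofaces d S vt.
  case: (lerP (#|star (v |: tau) S|%:R * (j.+1)`!%:R) (t ^+ j.+1)) => hlt.
    exact: IH.
  apply: (@le_trans _ _ (j.+2%:R * #|star tau S|%:R)).
    by rewrite ler_wpM2l // ler_nat.
  have f0 : 0 < (j.+1)`!%:R :> R by rewrite ltr0n fact_gt0.
  rewrite -(ler_pM2r f0) -mulrA mulrCA -natrM -factS.
  by apply: (le_trans hS); rewrite exprS -mulrA ler_wpM2l // ltW.
Qed.

(** The case of the empty face. For [s = t ^ d / d!] it reads [b <= t ^ (d + 1) / (d + 1)!], the
    Lovasz form of Kruskal-Katona with powers for falling factorials. *)
Lemma inner_cofaces_le (R : realType) (t : R) d S : (0 < d)%N -> 0 <= t ->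
  S \subset ksubsets n d -> #|S|%:R * d`!%:R <= t ^+ d ->
  (d.+1)%:R * #|inner_cofaces d S|%:R <= t * #|S|%:R.
Proof.
case: d => // d _ t0 Sd hS.
have star0 A : star set0 A = A by apply/setP => x; rewrite inE sub0set andbT.
have := @star_inner_cofaces_le _ t d.+1 S d set0 t0 Sd.
by rewrite cards0 !star0; apply.
Qed.

Definition cofaces d sigma := [set rho in ksubsets n d.+1 | sigma \subset rho].

Lemma card_cofaces d sigma : #|sigma| = d -> #|cofaces d sigma| = (n - d)%N.
Proof.
move=> hs; have -> : cofaces d sigma = [set v |: sigma | v in ~: sigma].
  apply/setP => rho; rewrite !inE; apply/andP/imsetP.
    move=> [/eqP hr sr]; have : #|rho :\: sigma| == 1%N.
      by rewrite cardsD (setIidPr sr) hr hs subSnn.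
    case/cards1P => v hv; have : v \in rho :\: sigma by rewrite hv set11.
    rewrite inE => /andP[vs vr]; exists v; first by rewrite inE.
    by rewrite -[LHS](setID rho sigma) (setIidPr sr) hv setUC.
  move=> [v]; rewrite inE => vs ->; rewrite cardsU1 vs hs eqxx; split=> //.
  exact: subsetUr.
rewrite card_in_imset => [|v w].
  by rewrite cardsCs setCK card_ord hs.
rewrite !inE => vs ws e; have : v \in w |: sigma by rewrite -e setU11.
by rewrite !inE (negbTE vs) orbF => /eqP.
Qed.

Definition mixed_cofaces d S := upper_boundary d S :\: inner_cofaces d S.

(** Each element of [S] has [n - d] cofaces; a mixed coface misses a facet, so at most [d] of its
    facets are in [S]. *)
Lemma sum_cofaces d S : S \subset ksubsets n d ->
  (#|S| * (n - d) <=
   d * #|mixed_cofaces d S| + d.+1 * #|inner_cofaces d S|)%N.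
Proof.
move=> /subsetP Sd.
have cS x : x \in S -> #|x| = d by move=> /Sd; rewrite inE => /eqP.
rewrite -sum_nat_const.
under eq_bigr => sigma sS do rewrite -(card_cofaces (cS _ sS)) -sum1_card big_mkcond.
rewrite exchange_big /= (bigID (fun rho => rho \in upper_boundary d S)) /=.
rewrite [X in (_ + X)%N]big1 ?addn0; last first.
  move=> rho rN; rewrite big1 // => sigma sS; case: ifP => //.
  rewrite !inE => /andP[hr sr]; rewrite !inE hr /= in rN.
  by case/existsP: rN; exists sigma; rewrite sS.
rewrite (bigID (fun rho => rho \in inner_cofaces d S)) /= addnC.
have le_facets rho : #|rho| = d.+1 ->
    (\sum_(sigma in S) (if rho \in cofaces d sigma then 1 else 0) =
     #|S :&: boundary d rho|)%N.
  move=> hr; rewrite -sum1_card big_mkcond [RHS]big_mkcond /=.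
  apply: eq_bigr => s _; rewrite !inE hr eqxx /=; case: (boolP (s \in S)) => //= sS.
  by rewrite cS // eqxx.
apply: leq_add.
  rewrite mulnC -sum_nat_const.
  rewrite [X in (_ <= X)%N](eq_bigl (fun rho => (rho \in upper_boundary d S) &&
     (rho \notin inner_cofaces d S))); last by move=> rho; rewrite !inE andbC.
  apply: leq_sum => rho /andP[rU rI].
  have hr : #|rho| = d.+1 by move: rU; rewrite !inE => /andP[/eqP].
  rewrite le_facets // -ltnS -(card_facets hr).
  apply: proper_card; rewrite properE subsetIr /=.
  apply: contra rI => h; rewrite inE rU; apply: subset_trans h _.
  exact: subsetIl.
rewrite mulnC -sum_nat_const.
rewrite [X in (_ <= X)%N](eq_bigl (fun rho => (rho \in upper_boundary d S) &&
   (rho \in inner_cofaces d S))); last first.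
  by move=> rho; rewrite !inE andbA andbb.
apply: leq_sum => rho /andP[rU rI].
have hr : #|rho| = d.+1 by move: rU; rewrite !inE => /andP[/eqP].
by rewrite le_facets // -[in X in (_ <= X)%N](card_facets hr) subset_leq_card ?subsetIr.
Qed.

Lemma mixed_cofaces_ge (R : realType) (t : R) d S : (0 < d)%N -> 0 <= t ->
  S \subset ksubsets n d -> #|S|%:R * d`!%:R <= t ^+ d ->
  #|S|%:R * (n%:R - d%:R - t) <= d%:R * #|mixed_cofaces d S|%:R.
Proof.
move=> d0 t0 Sd hS; have hB := inner_cofaces_le d0 t0 Sd hS.
have := sum_cofaces Sd; rewrite -(ler_nat R) natrD !natrM => h.
have : n%:R - d%:R <= (n - d)%:R :> R.
  by rewrite lerBlDr -natrD ler_nat; lia.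
move=> h2; have s0 : 0 <= #|S|%:R :> R by [].
nra.
Qed.

(** Count only cofaces with exactly one facet in [S], so nothing is counted twice. Another [s] in
    [S] spoils at most one coface of [sigma], namely [sigma :|: s]. *)
Lemma mixed_cofaces_ge_small d S : (0 < d)%N -> S \subset ksubsets n d ->
  (#|S| * (n - d - #|S|) <= #|mixed_cofaces d S|)%N.
Proof.
move=> d0 /subsetP Sd.
have cS x : x \in S -> #|x| = d by move=> /Sd; rewrite inE => /eqP.
pose U sigma := [set rho in cofaces d sigma |
  [forall s in S, (s \subset rho) ==> (s == sigma)]].
have cU sigma : sigma \in S -> (n - d - #|S| <= #|U sigma|)%N.
  move=> sS; rewrite leq_subLR -(card_cofaces (cS _ sS)).
  rewrite -(cardsID (U sigma)) addnC; apply: leq_add; last first.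
    by rewrite subset_leq_card ?subsetIr.
  apply: leq_trans (leq_imset_card (fun s => sigma :|: s) _).
  apply/subset_leq_card/subsetP => rho; rewrite !inE => /andP[+ /andP[hr sr]].
  rewrite hr sr /= => /forall_inPn[s sS' ]; rewrite negb_imply => /andP[sr' ne].
  apply/imsetP; exists s => //; apply/esym/eqP; rewrite eqEcard subUset sr sr' /=.
  rewrite (eqP hr) ltnNge; apply: contra ne => le.
  rewrite eqEcard (cS _ sS) (cS _ sS') leqnn andbT.
  have /eqP -> : sigma == sigma :|: s by rewrite eqEcard subsetUl (cS _ sS).
  exact: subsetUr.
have UE sigma rho : sigma \in S -> rho \in U sigma -> rho \in mixed_cofaces d S.
  move=> sS; rewrite !inE => /andP[/andP[hr sr] /forall_inP h].
  rewrite hr /=; have -> /= : [exists s in S, s \subset rho].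
    by apply/existsP; exists sigma; rewrite sS.
  rewrite andbT; apply/negP => /subsetP bS.
  have : boundary d rho \subset [set sigma].
    apply/subsetP => s sb; rewrite inE; apply: (implyP (h s (bS s sb))).
    by move: sb; rewrite inE => /andP[].
  by move=> /subset_leq_card; rewrite cards1 (card_facets (eqP hr)); case: (d) d0.
apply: (@leq_trans (\sum_(sigma in S) #|U sigma|)%N).
  by rewrite -sum_nat_const; apply: leq_sum.
under eq_bigr => sigma sS do rewrite -sum1_card big_mkcond /=.
rewrite exchange_big /= -sum1_card [X in (_ <= X)%N]big_mkcond; apply: leq_sum => rho _.
case: ifPn => [_|rE]; last first.
  by rewrite big1 // => s sS; case: ifP => // /(UE _ _ sS); rewrite (negbTE rE).
rewrite -big_mkcondr /= sum1_card; apply/card_le1_eqP => s1 s2.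
rewrite !unfold_in /= => /andP[S1 U1] /andP[S2 U2].
have {}U1 : rho \in U s1 by []; have {}U2 : rho \in U s2 by [].
move: U1 U2; rewrite !inE => /andP[/andP[_ r1] /forall_inP h1] /andP[/andP[_ r2] _].
by apply/eqP; apply: (implyP (h1 _ S2)).
Qed.

(** The Johnson graph. For [d > 0] it contains the relation [adjacent] of every complex, so the
    union bound runs over sets that do not depend on the random faces. *)
Definition johnson_adj d : rel {set 'I_n} := fun x y =>
  [&& #|x| == d, #|y| == d, x != y & #|x :|: y| == d.+1].

(** A neighbour arises by exchanging one element [a] of [x] for some [b]. *)
Lemma card_johnson_nbhs d x : (#|[set y | johnson_adj d x y]| <= d * n)%N.
Proof.
case: (eqVneq #|x| d) => [hx|hx]; last first.
  rewrite (_ : [set _ | _] = set0) ?cards0 //; apply/setP => y.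
  by rewrite !inE /johnson_adj (negbTE hx).
have -> : (d * n = #|setX x [set: 'I_n]|)%N by rewrite cardsX hx cardsT card_ord.
apply: leq_trans (leq_imset_card (fun ab => ab.2 |: (x :\ ab.1)) _).
apply/subset_leq_card/subsetP => y; rewrite inE => /and4P[_ /eqP hy ne /eqP hU].
have hI : (#|x :&: y|.+1 = d)%N by have := cardsUI x y; lia.
have /eqP/cards1P[a ha] : #|x :\: y| = 1%N by rewrite cardsD; lia.
have /eqP/cards1P[b hb] : #|y :\: x| = 1%N by rewrite cardsD setIC; lia.
apply/imsetP; exists (a, b) => /=.
  have : a \in x :\: y by rewrite ha set11.
  by rewrite !inE andbT => /andP[].
rewrite -hb -ha; apply/setP => z; rewrite !inE.
by case: (z \in x); case: (z \in y).
Qed.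

Lemma tightly_connected_cut d F S : (0 < d)%N -> F \subset ksubsets n d.+1 ->
  tightly_connected d (LM_complex d F) S ->
  S \subset ksubsets n d /\ cut_connected (johnson_adj d) S.
Proof.
move=> d0 Fd [SY conn]; split.
  by apply: subset_trans SY _; rewrite /faces prednK // subsetIr.
move=> A [x xA xS] clos; apply/subsetP => y yS.
case: (eqVneq x y) => [<- //|/eqP xy].
have [m [delta [m1 d0x dmy inS adj]]] := conn x y xS yS xy.
suff h i : (i <= m)%N -> delta i \in A by rewrite -dmy h.
elim: i => [_|i IH im]; first by rewrite d0x.
have [f1 f2 ne [rho rF [s1 s2]]] := adj i im.
apply: (clos (delta i)); rewrite ?IH ?inS // 1?ltnW //.
have c1 : #|delta i| = d by move: f1; rewrite !inE => /andP[_ /eqP ->]; rewrite prednK.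
have c2 : #|delta i.+1| = d by move: f2; rewrite !inE => /andP[_ /eqP ->]; rewrite prednK.
have cr : #|rho| = d.+1 by move: rF; rewrite !inE => /andP[_ /eqP].
rewrite /johnson_adj c1 c2 eqxx /=; apply/andP; split; first exact/eqP.
rewrite eqn_leq -{1}cr subset_leq_card ?subUset ?s1 //= ltnNge.
apply/negP => le; apply: ne.
have /eqP e1 : delta i == delta i :|: delta i.+1 by rewrite eqEcard subsetUl c1.
have /eqP e2 : delta i.+1 == delta i :|: delta i.+1 by rewrite eqEcard subsetUr c2.
by rewrite {1}e1 -e2.
Qed.

Lemma card_upper_boundary_le d S F : (#|upper_boundary d S :&: F| <=
  \sum_(sigma in S) #|cofaces d sigma :&: F|)%N.
Proof.
apply: (@leq_trans #|\bigcup_(sigma in S) (cofaces d sigma :&: F)|).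
  apply/subset_leq_card/subsetP => rho; rewrite !inE.
  move=> /andP[/andP[hr /existsP[s /andP[sS sr]]] rF].
  by apply/bigcupP; exists s; rewrite // !inE hr sr rF.
elim/big_rec2: _ => [|x m A _ leA]; first by rewrite cards0.
by apply: leq_trans (leq_card_setU _ _) _; apply: leq_add.
Qed.

End Isoperimetry.

(** * Union bound and weighted sums over families of sets *)

Section SumsOverSets.
Variable R : realType.

Lemma sum_union_bound (T I : finType) (w : T -> R) (Q Q0 : pred T)
    (P : pred I) (B : I -> pred T) :
  (forall x, 0 <= w x) ->
  (forall x, Q x -> Q0 x /\ exists2 i, P i & B i x) ->
  \sum_(x | Q x) w x <= \sum_(i | P i) \sum_(x | Q0 x && B i x) w x.
Proof.
move=> w0 hQ; under [leRHS]eq_bigr do rewrite big_mkcond /=.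
rewrite exchange_big big_mkcond /=; apply: ler_sum => x _.
case: ifPn => [/hQ[x0 [i Pi Bi]]|_]; last by apply: sumr_ge0 => i _; case: ifP.
rewrite (bigD1 i) //= x0 Bi /= lerDl; apply: sumr_ge0 => j _.
by case: ifP.
Qed.

(** With [z = y * #|V|], the sum is [(1 + y) ^ #|V| - 1 <= exp z - 1 <= z * exp z]. *)
Lemma sum_nonempty_expr (T : finType) (V : {set T}) (y : R) :
  0 <= y -> y * #|V|%:R <= 1 ->
  \sum_(S in powerset V | S != set0) y ^+ #|S| <= expR 1 * (y * #|V|%:R).
Proof.
move=> y0 yV1; set z := y * _ in yV1 *.
have z0 : 0 <= z by rewrite mulr_ge0.
have total : \sum_(S in powerset V) y ^+ #|S| = (1 + y) ^+ #|V|.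
  rewrite addrC -prodr_const -sum_powerset_prod; apply: eq_bigr => S.
  rewrite powersetE => /setIidPr SV; rewrite -prodr_const -[in LHS]SV.
  rewrite big_mkcond [RHS]big_mkcond /=; apply: eq_bigr => i _.
  by rewrite inE; case: (i \in V).
have : 1 + \sum_(S in powerset V | S != set0) y ^+ #|S| <= expR z.
  rewrite /z mulrC expRM_natl; apply: (@le_trans _ _ ((1 + y) ^+ #|V|)).
    rewrite -total [leRHS](bigD1 set0) /= ?powersetE ?sub0set // cards0 expr0.
    by rewrite lerD2l.
  by rewrite lerXn2r ?nnegrE ?expR_ge0 ?expR_ge1Dx // addr_ge0.
have ez : expR z <= expR 1 by rewrite ler_expR.
have := expR_ge1Dx (- z); have := expRxMexpNx_1 z; have := expR_gt0 z; nra.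
Qed.

(** There are [2 ^ #|V| <= exp #|V|] subsets in all. *)
Lemma sum_large_expR (T : finType) (V : {set T}) (y c : R) : 0 <= y ->
  \sum_(S in powerset V | c <= #|S|%:R) expR (- (y * #|S|%:R)) <=
  expR (#|V|%:R - y * c).
Proof.
move=> y0; apply: (@le_trans _ _ (\sum_(S in powerset V) expR (- (y * c)))).
  rewrite big_mkcondr /=; apply: ler_sum => S _.
  by case: ifP => h; rewrite ?expR_ge0 // ler_expR lerN2 ler_wpM2l.
rewrite sumr_const card_powerset -(mulr_natl _ (2 ^ _)) expRD ler_wpM2r ?expR_ge0 //.
rewrite -[#|V|%:R]mulr1 expRM_natl natrX lerXn2r ?nnegrE ?expR_ge0 //.
by have := expR_ge1Dx (1 : R); lra.
Qed.

Lemma bernoulli_ineq (x : R) m : 0 <= x <= 1 -> 1 - m%:R * x <= (1 - x) ^+ m.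
Proof.
case/andP => x0 x1; elim: m => [|m IH]; first by rewrite mul0r subr0.
have m0 : 0 <= m%:R :> R by [].
rewrite exprS -natr1; nra.
Qed.

Lemma sum_connected_expr (T : finType) (e : rel T) (D : nat) (V : {set T})
    (K : nat) (r : R) : (0 < D)%N -> 0 <= r <= 1 ->
  (forall y, (#|[set z | e y z]| <= D)%N) ->
  \sum_(S in powerset V | [&& S != set0, `[< cut_connected e S >] & (K <= #|S|)%N])
     (r / (4 * D%:R)) ^+ #|S| <= #|V|%:R * r ^+ K.
Proof.
move=> D0 /andP[r0 r1] hD; set z := r / _.
have D1 : 1 <= D%:R :> R by rewrite ler1n.
(* At this density Bernoulli's inequality gives [x * (1 - x) ^ D >= 1 / (4 * D)], so
   [sum_cut_connected] absorbs the weights [(4 * D) ^ (- #|S|)]. *)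
pose x : R := (2 * D%:R)^-1.
have xD : x * D%:R = 2^-1 by rewrite /x; field; rewrite pnatr_eq0; lia.
have x0 : 0 < x by rewrite invr_gt0; lra.
have x01 : 0 <= x <= 1 by apply/andP; split; nra.
have hz : (4 * D%:R)^-1 <= x * (1 - x) ^+ D.
  have -> : (4 * D%:R)^-1 = x * 2^-1 by rewrite /x; field; rewrite pnatr_eq0; lia.
  rewrite ler_pM2l //; apply: le_trans (bernoulli_ineq D x01); lra.
have z0 : 0 <= z by rewrite /z divr_ge0 // mulr_ge0.
apply: (@le_trans _ _ (\sum_(v in V) \sum_(S : {set T} |
    (v \in S) && `[< cut_connected e S >]) (x * (1 - x) ^+ D) ^+ #|S| * r ^+ K));
  last first.
  rewrite mulr_natl -sumr_const; apply: ler_sum => v _.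
  rewrite -mulr_suml ler_piMl ?exprn_ge0 //.
  exact: sum_cut_connected.
apply: le_trans (sum_union_bound
  (Q0 := fun S : {set T} => `[< cut_connected e S >] && (K <= #|S|)%N)
  (P := mem V) (B := fun v (S : {set T}) => v \in S) _ _) _.
- by move=> S; rewrite exprn_ge0.
- move=> S /andP[]; rewrite powersetE => SV /and3P[/set0Pn[v vS] -> ->].
  by split=> //; exists v => //; apply: (subsetP SV).
- apply: ler_sum => v _; under eq_bigl do rewrite andbAC andbC.
  rewrite [leRHS]big_mkcond [leLHS]big_mkcond /=; apply: ler_sum => S _.
  case: (v \in S) => //=; case: (`[< _ >]); rewrite ?andbT ?andbF //=.
  case: ifP => [KS|_]; last by rewrite mulr_ge0 ?exprn_ge0 ?mulr_ge0 ?exprn_ge0 //; lra.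
  rewrite /z exprMn mulrC ler_pM ?exprn_ge0 ?invr_ge0 ?mulr_ge0 //.
    by rewrite lerXn2r ?nnegrE ?invr_ge0 ?mulr_ge0 ?exprn_ge0 //; lra.
  by rewrite ler_wiXn2l.
Qed.

End SumsOverSets.

(** * Reduction to degree bounds and to failures of single sets *)

Section LinialMeshulam.
Variables (R : realType) (n d : nat).
Implicit Types (S F : {set {set 'I_n}}).

Lemma card_ksubsets k : #|ksubsets n k| = 'C(n, k).
Proof.
rewrite -[X in 'C(X, k)]card_ord -card_draws; apply: eq_card => s.
by rewrite !inE.
Qed.

Lemma bin_fact_le_expn k : ('C(n, k) * k`! <= n ^ k)%N.
Proof.
rewrite bin_ffact; elim: k => // k IH.
by rewrite ffactnSr expnSr leq_mul // leq_subr.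
Qed.

Definition expander_candidate S :=
  [&& S \subset ksubsets n d, S != set0,
      `[< cut_connected (@johnson_adj n d) S >] &
      #|S|%:R <= 2^-1 * 'C(n, d)%:R :> R].

(** At most [C * #|S|] cofaces of [S] are present, and [delta * C <= m]. *)
Lemma edge_expanding_degree (C m delta : R) F : (0 < d)%N -> F \subset ksubsets n d.+1 ->
  0 <= delta -> delta * C <= m ->
  (forall sigma, sigma \in ksubsets n d -> #|cofaces d sigma :&: F|%:R <= C) ->
  (forall S, expander_candidate S ->
     m * #|S|%:R <= #|mixed_cofaces d S :&: F|%:R) ->
  edge_expanding d delta (LM_complex d F).
Proof.
move=> d_gt0 Fd delta0 hm hdeg hS S /(tightly_connected_cut d_gt0 Fd)[SV conn] Shalf.
have -> : faces (LM_complex d F) d = F.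
  apply/setP => rho; rewrite !inE andb_orl.
  case: (boolP (rho \in F)) => [/(subsetP Fd)|_] /=.
    by rewrite inE => ->; rewrite orbT.
  by rewrite orbF; case: eqP => [->|_]; rewrite ?andbF // ltnn.
case: (eqVneq S set0) => [S0|S0].
  rewrite (_ : upper_boundary d S = set0) ?set0I ?cards0 ?mulr0 //.
  apply/setP => rho; rewrite !inE S0; apply/negbTE/negP => /andP[_ /existsP[s]].
  by rewrite inE.
apply: le_trans (hS S _); last first.
  by rewrite /expander_candidate SV S0 Shalf andbT; apply/asboolP.
apply: (@le_trans _ _ (delta * (C * #|S|%:R))); last first.
  by rewrite mulrA ler_wpM2r.
rewrite ler_wpM2l // mulrC mulr_natl -[C *+ _]sumr_const.
have := card_upper_boundary_le d S F; rewrite -(ler_nat R) natr_sum.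
by move/le_trans; apply; apply: ler_sum => s /(subsetP SV) /hdeg.
Qed.

Definition failure_prob (p m : R) S : R :=
  \sum_(F in powerset (ksubsets n d.+1) |
        #|mixed_cofaces d S :&: F|%:R <= m * #|S|%:R)
     bernoulli_weight p (ksubsets n d.+1) F.

(** An outcome that does not expand has a degree of at least [C] or, by [edge_expanding_degree], a
    failing candidate. *)
Lemma LM_prob_edge_expanding (p C m delta : R) : (0 < d)%N -> 0 <= p <= 1 ->
  0 <= delta -> delta * C <= m ->
  1 - LM_prob p d (@edge_expanding R n d delta) <=
  \sum_(sigma in ksubsets n d)
    \sum_(F in powerset (ksubsets n d.+1) | C <= #|cofaces d sigma :&: F|%:R)
       bernoulli_weight p (ksubsets n d.+1) F +
  \sum_(S | expander_candidate S)
    failure_prob p m S.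
Proof.
move=> d_gt0 p01 delta0 hm; set U := ksubsets n d.+1.
have w0 F : 0 <= bernoulli_weight p U F by exact: bernoulli_weight_ge0.
pose E F := `[< edge_expanding d delta (LM_complex d F) >].
pose bad F := [exists sigma in ksubsets n d, C <= #|cofaces d sigma :&: F|%:R].
have -> : 1 - LM_prob p d (@edge_expanding R n d delta) =
    \sum_(F | (F \in powerset U) && ~~ E F) bernoulli_weight p U F.
  rewrite -(sum_bernoulli_weight p U) (bigID E) /= /LM_prob.
  by rewrite addrC addrK.
rewrite (bigID bad) /=; apply: lerD; apply: sum_union_bound => // F.
  by move=> /andP[/andP[-> _] /existsP[s /andP[? ?]]]; split=> //; exists s.
move=> /andP[/andP[FU nE] nbad]; split=> //.
rewrite powersetE in FU.
have hdeg sigma : sigma \in ksubsets n d -> #|cofaces d sigma :&: F|%:R <= C.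
  move=> hs; rewrite leNgt; apply: contra nbad => /ltW h.
  by apply/existsP; exists sigma; rewrite hs.
case: (pselect (exists2 S, expander_candidate S &
    #|mixed_cofaces d S :&: F|%:R <= m * #|S|%:R)) => // nS.
case/negP: nE; apply/asboolP; apply: (edge_expanding_degree d_gt0 FU delta0 hm hdeg).
move=> S cS; rewrite leNgt; apply/negP => /ltW h; apply: nS; by exists S.
Qed.

Lemma degree_tail (p C : R) sigma : 0 <= p <= 1 -> sigma \in ksubsets n d ->
  \sum_(F in powerset (ksubsets n d.+1) | C <= #|cofaces d sigma :&: F|%:R)
     bernoulli_weight p (ksubsets n d.+1) F <=
  expR (n%:R * p * (expR 1 - 1) - C).
Proof.
move=> p01; rewrite inE => /eqP hs.
have sub : cofaces d sigma \subset ksubsets n d.+1.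
  by apply/subsetP => rho; rewrite inE => /andP[].
have := @bernoulli_weight_chernoff R _ p 1 C _ _ p01 sub.
under eq_bigl do rewrite !mul1r.
move/le_trans; apply; rewrite ler_expR mul1r lerD2r ler_wpM2r //.
have [p0 _] := andP p01.
by rewrite mulrC ler_wpM2r // ler_nat card_cofaces // leq_subr.
Qed.

Lemma mixed_tail (p lam m c : R) S : 0 <= p <= 1 -> 0 < lam ->
  c * #|S|%:R <= p * #|mixed_cofaces d S|%:R ->
  failure_prob p m S <= expR (- ((c * (1 - expR (- lam)) - lam * m) * #|S|%:R)).
Proof.
move=> p01 lam0 hc; rewrite /failure_prob.
have sub : mixed_cofaces d S \subset ksubsets n d.+1.
  by apply/subsetP => rho; rewrite !inE => /andP[_ /andP[]].
have := @bernoulli_weight_chernoff R _ p (- lam) (m * #|S|%:R) _ _ p01 sub.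
under eq_bigl do rewrite ler_nM2l ?oppr_lt0 //.
move/le_trans; apply; rewrite ler_expR.
have e1 : 0 <= 1 - expR (- lam) by rewrite subr_ge0 expR_le1; lra.
have := ler_wpM2r e1 hc; lra.
Qed.

End LinialMeshulam.

(** * Failure probability of a single candidate *)

Section Estimates.
Variables (R : realType) (n d K : nat) (p eps kappa mu L : R).
(** [mixed_tail] with [lam = 1 / kappa]: [exp (- lam) <= kappa] costs the factor [1 - kappa], and
    the threshold costs [lam * (kappa * mu * L) = mu * L]. *)
Lemma failure_le (c c' : R) (S : {set {set 'I_n}}) :
  0 <= p <= 1 -> 0 < kappa -> 0 <= L -> (0 < n)%N ->
  n%:R * p = (1 + eps) * d%:R * L -> 0 <= c ->
  c' + mu <= c * (1 - kappa) ->
  c * #|S|%:R * n%:R <= (1 + eps) * d%:R * #|mixed_cofaces d S|%:R ->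
  failure_prob d p (kappa * mu * L) S <= expR (- (c' * L)) ^+ #|S|.
Proof.
move=> p01 kappa_gt0 L_ge0 n_gt0 np_eq c0 hc' hc.
have lam0 : 0 < kappa^-1 by rewrite invr_gt0.
have he : expR (- kappa^-1) <= kappa.
  rewrite expRN -[leRHS]invrK lef_pV2 ?posrE ?expR_gt0 //.
  by have := expR_ge1Dx kappa^-1; lra.
have n0 : 0 < n%:R :> R by rewrite ltr0n.
have p0 : 0 <= p by case/andP: p01.
have hcL : c * L * #|S|%:R <= p * #|mixed_cofaces d S|%:R.
  rewrite -(ler_pM2l n0) (mulrA _ p) np_eq.
  have := ler_wpM2r L_ge0 hc; lra.
apply: (le_trans (mixed_tail _ p01 lam0 hcL)).
rewrite -expRM_natr ler_expR mulNr lerN2 ler_wpM2r //.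
have -> : kappa^-1 * (kappa * mu * L) = mu * L.
  by field; rewrite gt_eqF.
have := ler_wpM2r L_ge0 hc'.
have := ler_wpM2l (mulr_ge0 c0 L_ge0) (_ : 1 - kappa <= 1 - expR (- kappa^-1)).
by move=> /(_ ltac:(lra)); lra.
Qed.

(* The three terms are the three regimes; the constant [kappa] is chosen so   *)
(* that the margin [eps] survives the losses in [a] and in the Chernoff bound. *)
Lemma candidate_failure (S : {set {set 'I_n}}) :
  (0 < d)%N -> 0 <= p <= 1 -> 0 < kappa -> kappa <= 4^-1 -> 0 < eps ->
  1 + 2 * kappa <= (1 - kappa) ^+ 2 * (1 + eps) ->
  mu <= kappa -> mu <= (16 * d%:R)^-1 -> 0 <= L ->
  n%:R * p = (1 + eps) * d%:R * L ->
  d%:R + K%:R <= kappa / 2 * n%:R -> d%:R * (4 * d%:R) <= n%:R :> R ->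
  expander_candidate R d S ->
  failure_prob d p (kappa * mu * L) S <= expR (- ((d%:R + kappa) * L)) ^+ #|S| +
  (if (K <= #|S|)%N then expR (- ((1 + kappa) * L)) ^+ #|S| else 0) +
  (if (kappa / 2 * n%:R) ^+ d / d`!%:R <= #|S|%:R
   then expR (- ((16 * d%:R)^-1 * L * #|S|%:R)) else 0).
Proof.
move=> d_gt0 p01 kappa_gt0 kappa_le eps_gt0 kappa_eps mu_kappa mu_d L_ge0 np_eq.
move=> n_large n_large_d /and4P[SV S0 _ Shalf].
have n_gt0 : (0 < n)%N.
  by rewrite -(ltr0n R); apply: lt_le_trans n_large_d; rewrite !mulr_gt0 ?ltr0n.
have d1 : 1 <= d%:R :> R by rewrite ler1n.
have s0 : 0 <= #|S|%:R :> R by [].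
have k0 : 0 <= K%:R :> R by [].
have n0 : 0 <= n%:R :> R by [].
have f0 : 0 < d`!%:R :> R by rewrite ltr0n fact_gt0.
case: (leqP #|S| K) => [sK|Ks].
  rewrite -addrA; apply: ler_wpDr.
    by apply: addr_ge0; case: ifP => _; rewrite ?exprn_ge0 ?expR_ge0.
  apply: (@failure_le ((1 - kappa) * (1 + eps) * d%:R)) => //.
  - by rewrite !mulr_ge0 //; lra.
  - have : (1 + 2 * kappa) * d%:R <= (1 - kappa) ^+ 2 * (1 + eps) * d%:R.
      by rewrite ler_wpM2r.
    nra.
  - have h : #|S|%:R * (n%:R - d%:R - K%:R) <= #|mixed_cofaces d S|%:R :> R.
      have := mixed_cofaces_ge_small d_gt0 SV; rewrite -(ler_nat R) natrM.
      apply: le_trans; rewrite ler_wpM2l // -subnDA lerBlDr lerBlDr.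
      by rewrite -!natrD ler_nat; clear -sK; lia.
    rewrite (_ : _ * _ * _ * _ * _ = (1 + eps) * d%:R *
      (#|S|%:R * ((1 - kappa) * n%:R))); last by ring.
    rewrite ler_wpM2l ?mulr_ge0 //; first by lra.
    apply: le_trans h; rewrite ler_wpM2l //; nra.
rewrite (ltnW Ks).
(* Middle regime: [t = kappa / 2 * n] loses only a small part of [n]. *)
case: (lerP (#|S|%:R * d`!%:R) ((kappa / 2 * n%:R) ^+ d)) => [hs|/ltW hs].
  rewrite addrAC addrC; apply: ler_wpDr.
    by apply: addr_ge0; last case: ifP => _; rewrite ?exprn_ge0 ?expR_ge0.
  apply: (@failure_le ((1 - kappa) * (1 + eps))) => //.
  - by rewrite !mulr_ge0 //; lra.
  - by nra.
  - have t0 : 0 <= kappa / 2 * n%:R by rewrite mulr_ge0 //; lra.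
    have h := mixed_cofaces_ge d_gt0 t0 SV hs.
    rewrite (_ : _ * _ * _ * _ = (1 + eps) * (#|S|%:R * ((1 - kappa) * n%:R))); last by ring.
    rewrite -mulrA ler_wpM2l //; first by lra.
    apply: le_trans h; rewrite ler_wpM2l //; nra.
rewrite ler_pdivrMr // hs addrC; apply: ler_wpDr.
  by apply: addr_ge0; rewrite exprn_ge0 ?expR_ge0.
rewrite -mulNr expRM_natr.
apply: (@failure_le ((1 + eps) / (4 * d%:R))) => //.
- by rewrite divr_ge0 ?mulr_ge0 //; lra.
- have i0 : 0 < d%:R^-1 :> R by rewrite invr_gt0; lra.
  rewrite !invfM in mu_d *; nra.
(* By Bernoulli's inequality [t ^ d >= n ^ d / 2], which half of all [d]-sets cannot exceed after
   multiplying by [d!]; and [n - d - t >= n / (4 * d)] remains. *)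
- pose t : R := (1 - (2 * d%:R)^-1) * n%:R.
  have i01 : 0 <= ((2 * d%:R)^-1 : R) <= 1.
    by apply/andP; split; rewrite ?invr_ge0 ?invf_le1; lra.
  have t0 : 0 <= t by rewrite mulr_ge0 //; lra.
  have ht : #|S|%:R * d`!%:R <= t ^+ d.
    rewrite exprMn; apply: (@le_trans _ _ (2^-1 * n%:R ^+ d)).
      apply: (@le_trans _ _ (2^-1 * 'C(n, d)%:R * d`!%:R)); first by rewrite ler_wpM2r // ltW.
      rewrite -mulrA ler_wpM2l // -natrM -natrX ler_nat.
      exact: bin_fact_le_expn.
    rewrite ler_wpM2r ?exprn_ge0 //; apply: le_trans (bernoulli_ineq d i01).
    rewrite invfM mulrCA divff ?mulr1; last by rewrite gt_eqF //; lra.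
    by lra.
  have h := mixed_cofaces_ge d_gt0 t0 SV ht.
  rewrite -[leRHS]mulrA.
  apply: (@le_trans _ _ ((1 + eps) * (#|S|%:R * (n%:R - d%:R - t)))); last first.
    by rewrite ler_wpM2l //; lra.
  rewrite -!mulrA ler_wpM2l //; first by lra.
  rewrite mulrCA ler_wpM2l // /t.
  have -> : n%:R - d%:R - (1 - (2 * d%:R)^-1) * n%:R =
            (2 * d%:R)^-1 * n%:R - d%:R :> R by ring.
  have hd : d%:R <= (4 * d%:R)^-1 * n%:R :> R.
    by rewrite ler_pdivlMl; lra.
  have e2 : (2 * d%:R)^-1 = 2 * (4 * d%:R)^-1 :> R by field; rewrite gt_eqF //; lra.
  by rewrite e2; lra.
Qed.

End Estimates.

Lemma ler_sum_subpred (R : realType) (I : finType) (P Q : pred I) (F : I -> R) :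
  (forall i, P i -> Q i) -> (forall i, 0 <= F i) ->
  \sum_(i | P i) F i <= \sum_(i | Q i) F i.
Proof.
move=> PQ F0; rewrite [leLHS]big_mkcond [leRHS]big_mkcond /=; apply: ler_sum => i _.
by case: ifPn => [/PQ ->|_] //; case: ifP.
Qed.

(** * Summation over all candidates and all degrees *)

Section UnionBounds.
Variables (R : realType) (n d K : nat) (p eps kappa mu L : R).

Lemma sum_candidate_failure :
  (0 < d)%N -> 0 <= p <= 1 -> 0 < kappa -> kappa <= 4^-1 -> 0 < eps ->
  1 + 2 * kappa <= (1 - kappa) ^+ 2 * (1 + eps) ->
  mu <= kappa -> mu <= (16 * d%:R)^-1 -> 0 <= L -> n%:R = expR L ->
  n%:R * p = (1 + eps) * d%:R * L ->
  d%:R + K%:R <= kappa / 2 * n%:R -> d%:R * (4 * d%:R) <= n%:R :> R ->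
  d%:R + 1 <= kappa * K%:R -> 4 * d%:R <= expR (kappa * L) ->
  2 <= (16 * d%:R)^-1 * L * ((kappa / 2) ^+ d / d`!%:R) ->
  \sum_(S | expander_candidate (n := n) R d S)
     failure_prob d p (kappa * mu * L) S <=
  (expR 1 + (4 * d%:R) ^+ K + 1) * expR (- (kappa * L)).
Proof.
have cancel (a b x : R) : a != 0 -> b != 0 -> b^-1 * x = 4 * a * x / (4 * (a * b)).
  by move=> a0 b0; field; rewrite a0 b0.
move=> d_gt0 p01 kappa_gt0 kappa_le eps_gt0 kappa_eps mu_kappa mu_d L_ge0 nE np_eq.
move=> n_large n_large_d hK hL2 hL3.
have n_gt0 : (0 < n)%N by rewrite -(ltr0n R) nE expR_gt0.
have d1 : 1 <= d%:R :> R by rewrite ler1n.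
have binE : #|ksubsets n d|%:R <= expR (d%:R * L) :> R.
  rewrite expRM_natl -nE -natrX ler_nat card_ksubsets.
  by apply: leq_trans (bin_fact_le_expn n d); rewrite leq_pmulr ?fact_gt0.
have kL1 : expR (- (kappa * L)) <= 1.
  by rewrite expR_le1 oppr_le0 mulr_ge0 // ltW.
have kL : kappa * L <= L by nra.
apply: (@le_trans _ _ (\sum_(S | expander_candidate R d S) _)).
  by apply: ler_sum => S /candidate_failure; apply; eassumption.
rewrite !big_split /= (mulrDl (_ + _) 1) mul1r (mulrDl (expR 1)).
apply: lerD; first apply: lerD.
- set y := expR (- ((d%:R + kappa) * L)).
  have yN : y * #|ksubsets n d|%:R <= expR (- (kappa * L)).
    apply: le_trans (ler_wpM2l (expR_ge0 _) binE) _.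
    by rewrite -expRD ler_expR; lra.
  apply: le_trans (_ : expR 1 * (y * #|ksubsets n d|%:R) <= _); last first.
    by rewrite ler_wpM2l ?expR_ge0.
  apply: le_trans (sum_nonempty_expr (expR_ge0 _) (le_trans yN kL1)).
  apply: ler_sum_subpred => [S /and4P[SV -> _ _]|S]; last by rewrite exprn_ge0 ?expR_ge0.
  by rewrite powersetE SV.
(* Chosen so that [r / (4 * d * n) = n ^ (- (1 + kappa))]. As [kappa * K >= d + 1], the factor
   [r ^ K] beats the [n ^ d] choices of a root. *)
- pose r := 4 * d%:R * expR (- (kappa * L)).
  have r01 : 0 <= r <= 1.
    rewrite mulr_ge0 ?mulr_ge0 ?expR_ge0 //=.
    by rewrite /r expRN ler_pdivrMr ?expR_gt0 // mul1r.
  have D0 : (0 < d * n)%N by rewrite muln_gt0 d_gt0.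
  rewrite -big_mkcondr /=.
  have yE : expR (- ((1 + kappa) * L)) = r / (4 * (d * n)%N%:R).
    rewrite mulrDl mul1r opprD expRD expRN natrM -nE /r.
    by apply: cancel; rewrite pnatr_eq0 -lt0n.
  apply: (@le_trans _ _ (#|ksubsets n d|%:R * r ^+ K)).
    apply: le_trans (sum_connected_expr (ksubsets n d) K D0 r01 (@card_johnson_nbhs n d)).
    rewrite yE; apply: ler_sum_subpred => [S|S].
      by move=> /andP[/and4P[SV -> -> _] ->]; rewrite powersetE SV.
    by rewrite exprn_ge0 // -yE expR_ge0.
  rewrite /r exprMn mulrCA ler_wpM2l ?exprn_ge0 ?mulr_ge0 //.
  apply: le_trans (ler_wpM2r (exprn_ge0 _ (expR_ge0 _)) binE) _.
  rewrite -expRM_natr -expRD ler_expR.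
  have := ler_wpM2r L_ge0 hK; lra.
- rewrite -big_mkcondr /=.
  have y0 : 0 <= (16 * d%:R)^-1 * L by rewrite mulr_ge0 // invr_ge0 mulr_ge0.
  set c := (_ / d`!%:R).
  apply: (@le_trans _ _ (\sum_(S in powerset (ksubsets n d) | c <= #|S|%:R)
      expR (- ((16 * d%:R)^-1 * L * #|S|%:R)))).
    apply: ler_sum_subpred => [S|S]; last exact: expR_ge0.
    by move=> /andP[/and4P[SV _ _ _] ->]; rewrite powersetE SV.
  (* By [hL3] the exponent is at most [n ^ d - 2 * n ^ d <= - L]. *)
  apply: le_trans (sum_large_expR _ _ y0) _; rewrite ler_expR {}/c.
  have N1 : #|ksubsets n d|%:R <= n%:R ^+ d :> R.
    by apply: le_trans binE _; rewrite expRM_natl -nE.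
  have N2 : L <= n%:R ^+ d.
    apply: (@le_trans _ _ n%:R); first by rewrite nE; have := expR_ge1Dx L; lra.
    by rewrite -natrX ler_nat -[leqLHS]expn1 leq_pexp2l.
  have N0 : 0 <= n%:R ^+ d :> R by rewrite exprn_ge0.
  have := ler_wpM2r N0 hL3; rewrite (exprMn _ (kappa / 2)).
  lra.
Qed.

(** [C] makes each tail at most [n ^ (- (d + 1))], against at most [n ^ d] sets [sigma]. *)
Lemma sum_degree_tail (C : R) :
  0 <= p <= 1 -> 0 <= L -> kappa <= 4^-1 -> n%:R = expR L ->
  n%:R * p = (1 + eps) * d%:R * L ->
  C = ((1 + eps) * d%:R * (expR 1 - 1) + d%:R + 1) * L ->
  \sum_(sigma in ksubsets n d)
    \sum_(F in powerset (ksubsets n d.+1) | C <= #|cofaces d sigma :&: F|%:R)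
       bernoulli_weight p (ksubsets n d.+1) F <= expR (- (kappa * L)).
Proof.
move=> p01 L_ge0 kappa_le nE np_eq CE.
apply: (@le_trans _ _ (\sum_(sigma in ksubsets n d) expR (- ((d%:R + 1) * L)))).
  apply: ler_sum => sigma hs; apply: le_trans (degree_tail C p01 hs) _.
  by rewrite np_eq CE ler_expR; lra.
rewrite sumr_const -(mulr_natl _ #|_|).
apply: (@le_trans _ _ (expR (d%:R * L) * expR (- ((d%:R + 1) * L)))).
  rewrite ler_wpM2r ?expR_ge0 // expRM_natl -nE -natrX ler_nat card_ksubsets.
  by apply: leq_trans (bin_fact_le_expn n d); rewrite leq_pmulr ?fact_gt0.
rewrite -expRD ler_expR; have := ler_wpM2r L_ge0 kappa_le; lra.
Qed.

End UnionBounds.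

(** * Choice of constants and the limit *)

Lemma LM_prob_le1 (R : realType) (n d : nat) (p : R) E :
  0 <= p <= 1 -> LM_prob (n := n) p d E <= 1.
Proof.
move=> p01; rewrite -(sum_bernoulli_weight p (ksubsets n d.+1)).
apply: ler_sum_subpred => [F /andP[]|F] //.
exact: bernoulli_weight_ge0.
Qed.

Lemma LM_prob_edge_expanding_ge (R : realType) (d : nat) (eps : R) :
  (0 < d)%N -> 0 < eps ->
  exists delta C kappa M : R, [/\ 0 < delta, 0 < C, 0 < kappa &
    forall (n : nat) (p : R), 0 <= p <= 1 -> M <= ln n%:R ->
      n%:R * p = (1 + eps) * d%:R * ln n%:R ->
      1 - LM_prob p d (@edge_expanding R n d delta) <=
      C * expR (- (kappa * ln n%:R))].
Proof.
move=> d_gt0 eps_gt0.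
have d1 : 1 <= d%:R :> R by rewrite ler1n.
(* Then [(1 - kappa) ^ 2 * (1 + eps) >= (1 - 2 * kappa) * (1 + eps) = 1 + eps / 2 >= 1 + 2 *
   kappa]. *)
pose kappa := eps / (4 * (1 + eps)).
have kE : kappa * (4 * (1 + eps)) = eps by rewrite /kappa divfK // gt_eqF //; lra.
have kappa_gt0 : 0 < kappa by rewrite divr_gt0 //; lra.
have kappa_le : kappa <= 4^-1 by nra.
have kappa_eps : 1 + 2 * kappa <= (1 - kappa) ^+ 2 * (1 + eps) by nra.
clearbody kappa.
pose mu := Num.min kappa (16 * d%:R)^-1.
have mu_gt0 : 0 < mu by rewrite lt_min kappa_gt0 invr_gt0; lra.
have mu_kappa : mu <= kappa by rewrite ge_min lexx.
have mu_d : mu <= (16 * d%:R)^-1 by rewrite ge_min lexx orbT.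
clearbody mu.
pose K := Num.bound ((d%:R + 1) / kappa).
have hK : d%:R + 1 <= kappa * K%:R.
  rewrite mulrC -ler_pdivrMr // ltW // archi_boundP // divr_ge0 ?ltW //; lra.
clearbody K.
have e1 : 2 <= expR 1 :> R by have := expR_ge1Dx (1 : R); lra.
pose C1 := (1 + eps) * d%:R * (expR 1 - 1) + d%:R + 1.
have C1_gt0 : 0 < C1.
  have : 0 <= (1 + eps) * d%:R * (expR 1 - 1) by rewrite !mulr_ge0 //; lra.
  by rewrite /C1; lra.
pose c3 := (16 * d%:R)^-1 * ((kappa / 2) ^+ d / d`!%:R).
have c3_gt0 : 0 < c3.
  have ? : 0 < d%:R :> R by lra.
  by rewrite mulr_gt0 ?invr_gt0 ?divr_gt0 ?exprn_gt0 ?mulr_gt0 ?ltr0n ?fact_gt0.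
pose M1 := 2 * (d%:R + K%:R) / kappa.
pose M2 := 4 * d%:R / kappa.
pose M3 := 2 / c3.
have M1_ge0 : 0 <= M1 by rewrite divr_ge0 ?mulr_ge0 ?addr_ge0 // ltW.
have M2_ge0 : 0 <= M2 by rewrite divr_ge0 ?mulr_ge0 // ltW.
have M3_ge0 : 0 <= M3 by rewrite divr_ge0 // ltW.
have dd_ge0 : 0 <= d%:R * (4 * d%:R) :> R by rewrite !mulr_ge0.
(* [delta] is the ratio of the threshold [kappa * mu * L] to the degree bound [C1 * L]; the 2 is the
   1 of [sum_candidate_failure] plus the degree tail. *)
exists (kappa * mu / C1), (expR 1 + (4 * d%:R) ^+ K + 2), kappa,
  (1 + d%:R * (4 * d%:R) + M1 + M2 + M3); split=> //.
  by rewrite divr_gt0 ?mulr_gt0.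
move=> n p p01; set L := ln n%:R => hL np_eq.
have L1 : 1 <= L by lra.
have n_gt0 : 0 < n%:R :> R.
  (* [ln] is 0 at nonpositive arguments, so [L >= 1] excludes [n = 0]. *)
  by rewrite ltNge; apply/negP => /ln0; rewrite -/L; lra.
have nE : n%:R = expR L :> R by rewrite lnK // posrE.
clearbody L.
have nL : L <= n%:R by rewrite nE; have := expR_ge1Dx L; lra.
have L_ge0 : 0 <= L by lra.
have h1 : d%:R + K%:R <= kappa / 2 * n%:R.
  have : M1 <= n%:R by lra.
  by rewrite /M1 ler_pdivrMr //; lra.
have h2 : d%:R * (4 * d%:R) <= n%:R :> R by lra.
have h3 : 4 * d%:R <= expR (kappa * L).
  have : M2 <= L by lra.
  by rewrite /M2 ler_pdivrMr //; have := expR_ge1Dx (kappa * L); lra.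
have h4 : 2 <= (16 * d%:R)^-1 * L * ((kappa / 2) ^+ d / d`!%:R).
  have : M3 <= L by lra.
  by rewrite /M3 ler_pdivrMr // /c3; lra.
have hdelta : kappa * mu / C1 * (C1 * L) <= kappa * mu * L.
  by rewrite mulrA divfK // gt_eqF.
have delta0 : 0 <= kappa * mu / C1 by rewrite divr_ge0 ?mulr_ge0 // ltW.
apply: le_trans (LM_prob_edge_expanding n d_gt0 p01 delta0 hdelta) _.
have := sum_candidate_failure d_gt0 p01 kappa_gt0 kappa_le eps_gt0 kappa_eps
  mu_kappa mu_d L_ge0 nE np_eq h1 h2 hK h3 h4.
have := sum_degree_tail p01 L_ge0 kappa_le nE np_eq (erefl (C1 * L)).
lra.
Qed.

Local Open Scope classical_set_scope.
Local Open Scope ring_scope.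

Theorem theorem5p1 (R : realType) (d : nat) (eps : R) (p : nat -> R)
    (hd : (0 < d)%N) (heps : 0 < eps)
    (hp01 : forall n : nat, 0 <= p n <= 1)
    (hp : \forall n \near \oo, n%:R * p n = (1 + eps) * d%:R * ln n%:R) :
  exists2 delta : R, 0 < delta &
    LM_prob (p n) d (@edge_expanding R n d delta) @[n --> \oo] --> (1 : R).
Proof.
have [delta [C [kappa [M [delta0 C0 kappa0 bound]]]]] :=
  LM_prob_edge_expanding_ge hd heps.
exists delta => //; apply/cvgrPdist_le => e e0.
near=> n.
have n_gt0 : 0 < n%:R :> R by near: n; exact: nbhs_infty_gtr.
have lnM : M <= ln n%:R.
  by rewrite -ler_expR lnK ?posrE //; near: n; exact: nbhs_infty_ger.
(* This suffices for [C * exp (- kappa * ln n) <= e], as [exp u >= 1 + u]. *)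
have lnC : C / (kappa * e) <= ln n%:R.
  by rewrite -ler_expR lnK ?posrE //; near: n; exact: nbhs_infty_ger.
rewrite ger0_norm ?subr_ge0 ?LM_prob_le1 //.
apply: le_trans (bound n (p n) (hp01 n) lnM _) _; first by near: n.
rewrite expRN ler_pdivrMr ?expR_gt0 //.
rewrite ler_pdivrMr ?mulr_gt0 // in lnC.
have := expR_ge1Dx (kappa * ln n%:R); nra.
Unshelve. all: by end_near.
Qed.
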